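(* Let $G$ be a connected interval graph on $n$ vertices. If $G$ is not a complete graph, then $G$ is equitably $\Delta(G)$-colorable.
   Context: All graphs are finite, loopless, and without multiple edges. $\Delta(G)$ denotes the maximum degree of $G$. A graph $G=(V,E)$ is an interval graph if there is a family $\{I_v \mid v\in V\}$ of intervals on the real line such that distinct vertices $u$ and $v$ are adjacent if and only if $I_u\cap I_v\neq\emptyset$. A proper $k$-coloring of $G$ is a function $c:V(G)\to\{0,1,\ldots,k-1\}$ mapping adjacent vertices to distinct numbers; its color classes are $V_i=c^{-1}(i)$, $0\leqslant i\leqslant k-1$. $G$ is equitably $k$-colorable if it has a proper $k$-coloring whose color classes satisfy $\big||V_i|-|V_j|\big|\leqslant 1$ for all $i,j\in\{0,\ldots,k-1\}$. *)

(* Defs.v *)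
From HB Require Import structures.
From mathcomp Require Import all_boot all_order all_algebra.
From mathcomp Require Import reals.

Set Implicit Arguments.
Unset Strict Implicit.
Unset Printing Implicit Defensive.

Record sgraph := SGraph {
  vertex :> finType;
  adj : rel vertex;
  adj_sym : symmetric adj;
  adj_irrefl : irreflexive adj
}.

Definition nbhd (G : sgraph) (v : G) : {set G} := [set w | adj v w].

Definition max_degree (G : sgraph) : nat := \max_(v : G) #|nbhd v|.

Definition connected_graph (G : sgraph) : Prop :=
  forall u v : G, connect (@adj G) u v.

Definition complete_graph (G : sgraph) : Prop :=
  forall u v : G, u != v -> adj u v.

(* [interval R] covers every kind of real interval: open, closed, half-open,
   bounded or not, degenerate.  It also contains empty ones; allowing them does
   not enlarge the class, since an empty interval only makes its vertex
   isolated. *)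
Definition interval_graph (R : realType) (G : sgraph) : Prop :=
  exists I : G -> interval R, forall u v : G, u != v ->
    (adj u v <-> exists x : R, x \in I u /\ x \in I v).

Definition proper_coloring (G : sgraph) (k : nat) (c : G -> 'I_k) : Prop :=
  forall u v : G, adj u v -> c u != c v.

Definition color_class (G : sgraph) (k : nat) (c : G -> 'I_k) (i : 'I_k) :
  {set G} := [set v | c v == i].

Definition equitably_colorable (G : sgraph) (k : nat) : Prop :=
  exists c : G -> 'I_k, proper_coloring c /\
    forall i j : 'I_k,
      (`| #|color_class c i|%:Z - #|color_class c j|%:Z | <= 1)%R.

(* Main.v *)
Require Import Defs.
From mathcomp Require Import all_boot all_order all_algebra.
From mathcomp Require Import reals.
From mathcomp Require Import zify.

(** Write [D] for the maximum degree and enumerate the vertices as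
    [u_0, u_1, ...]; giving [u_i] the colour [i mod D] makes the classes as equal
    as possible ([equitable_of_enumeration]).  Everything rests on choosing the
    enumeration so that this colouring is proper, that is, so that no edge joins
    [u_i] to [u_j] with [i + D <= j].

    The intervals may be taken closed ([interval_graph_closed]).  The enumeration
    puts first the interval [u_0] that ends first, and then the other intervals
    by left endpoint ([simplicial_umbrella_enumeration]).  It has two properties.
    If [u_a] is adjacent to [u_b], it is adjacent to every vertex between them
    ([umbrella_free]): for [a > 0] the left endpoints of these vertices lie in
    [u_a], and for [a = 0] these vertices contain the right endpoint of [u_0].
    The neighbours of [u_0] form a clique, because they all contain that point.

    Suppose that [u_i] is adjacent to [u_j] with [i + D <= j]
    ([no_long_edge]).  Then [u_i] already has [D] neighbours among
    [u_{i+1}, ..., u_j].  If [i > 0], connectedness gives an edge from an earlier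
    vertex across the cut before [u_i]; as the enumeration is umbrella-free, the
    earlier vertex is adjacent to [u_i], whose degree exceeds [D].  If [i = 0],
    then [u_0, ..., u_j] is a clique of at least [D + 1] vertices.  Either it is
    the whole graph, which is then complete, or an edge leaves it and its end in
    the clique has degree more than [D]. *)

Set Implicit Arguments.
Unset Strict Implicit.
Unset Printing Implicit Defensive.

Import Order.TTheory.

(** * Colouring cyclically along an enumeration *)

Lemma count_modn_iota (k i n : nat) : i < k ->
  count (fun j => j %% k == i) (iota 0 n) = n %/ k + (i < n %% k).
Proof.
move=> ik; have k0 : 0 < k by apply: leq_ltn_trans ik.
elim: n => [|n IHn]; first by rewrite div0n mod0n.
rewrite -[n.+1]addn1 iotaD count_cat IHn /= add0n addn0 addn1.
have nk : n %% k < k by rewrite ltn_mod.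
rewrite divnS // modnS.
case: ifP => kn /=; last by lia.
have : k %| (n %% k).+1.
  by rewrite -(dvdn_addr _ (dvdn_mull (n %/ k) (dvdnn k))) addnS -divn_eq.
by move=> /dvdn_leq; lia.
Qed.

Lemma card_color_class_modn (G : sgraph) (s : seq G) (k : nat) (c : G -> 'I_k)
    (i : 'I_k) :
  uniq s -> (forall v, v \in s) -> (forall v, c v = index v s %% k :> nat) ->
  #|color_class c i| = size s %/ k + (i < size s %% k).
Proof.
move=> us alls cE; rewrite -count_modn_iota //.
have -> : iota 0 (size s) = map (index^~ s) s.
  case: s us {alls cE} => [//|x0 s] us.
  apply: (@eq_from_nth _ 0); rewrite ?size_map ?size_iota // => j js.
  by rewrite nth_iota // (nth_map x0) // index_uniq.
rewrite count_map -size_filter cardE.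
apply: perm_size; apply: uniq_perm; rewrite ?enum_uniq ?filter_uniq // => v.
by rewrite mem_enum inE mem_filter alls andbT /= -cE.
Qed.

Lemma equitable_of_enumeration (G : sgraph) (x0 : G) (s : seq G) (k : nat) :
  0 < k -> uniq s -> (forall v, v \in s) ->
  (forall i j, i + k <= j -> j < size s -> ~~ adj (nth x0 s i) (nth x0 s j)) ->
  equitably_colorable G k.
Proof.
move=> k0 us alls sep.
pose c v : 'I_k := Ordinal (ltn_pmod (index v s) k0).
exists c; split=> [u v uv|i j]; last first.
  rewrite !(card_color_class_modn _ us alls) //; lia.
apply/eqP => /(congr1 val) /= cuv.
have far x y : index x s < index y s -> index x s = index y s %[mod k] ->
    ~~ adj x y.
  move=> xy e.
  rewrite -(nth_index x0 (alls x)) -(nth_index x0 (alls y)).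
  apply: sep; last by rewrite index_mem.
  have /eqP := e; rewrite eq_sym (eqn_mod_dvd _ (ltnW xy)) => kd.
  have : 0 < index y s - index x s by rewrite subn_gt0.
  by move=> /dvdn_leq /(_ kd); lia.
case: (ltngtP (index u s) (index v s)) => [lt|lt|eq].
- by move: (far _ _ lt cuv); rewrite uv.
- by move: (far _ _ lt (esym cuv)); rewrite adj_sym uv.
- move: uv; rewrite -(nth_index x0 (alls u)) eq nth_index //.
  by rewrite adj_irrefl.
Qed.

(** * Connected graphs along an enumeration *)

Lemma adj_neq (G : sgraph) (u v : G) : adj u v -> u != v.
Proof. by apply: contraTneq => ->; rewrite adj_irrefl. Qed.

Lemma connected_has_neighbor (G : sgraph) (v : G) :
  connected_graph G -> ~ complete_graph G -> exists u, adj v u.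
Proof.
move=> conn ncomp; apply/existsP; apply: contra_notT ncomp.
rewrite negb_exists => /forallP isol.
have only u : u = v.
  have /connectP[[|y p] /=] := conn v u; first by [].
  by rewrite (negPf (isol y)).
by move=> u w; rewrite (only u) (only w) eqxx.
Qed.

Lemma connected_crossing_edge (G : sgraph) (x0 : G) (s : seq G) (m : nat) :
  connected_graph G -> uniq s -> (forall v, v \in s) -> 0 < m < size s ->
  exists a b, [/\ a < m, m <= b, b < size s & adj (nth x0 s a) (nth x0 s b)].
Proof.
move=> conn us alls /andP[m0 ms].
case: (boolP [exists x, exists y, [&& index x s < m, m <= index y s & adj x y]]).
  case/existsP=> x /existsP[y /and3P[xm my xy]].
  by exists (index x s), (index y s); rewrite index_mem !nth_index.
rewrite negb_exists => /forallP none.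
have step x y : adj x y -> index x s < m -> index y s < m.
  move=> xy xm; have := none x; rewrite negb_exists => /forallP/(_ y).
  by rewrite xm xy andbT /= -ltnNge.
have cl : closed (@adj G) [pred x | index x s < m].
  move=> x y xy; rewrite !inE; apply/idP/idP; first exact: step.
  by apply: step; rewrite adj_sym.
have := closed_connect cl (conn (nth x0 s 0) (nth x0 s m)).
by rewrite !inE !index_uniq ?m0 ?ltnn // (leq_ltn_trans _ ms).
Qed.

Lemma leq_max_degree (G : sgraph) (x0 v : G) (s : seq G) (t : seq nat) :
  uniq s -> uniq t ->
  (forall i, i \in t -> i < size s /\ adj v (nth x0 s i)) ->
  size t <= max_degree G.
Proof.
move=> us ut tP; rewrite -(size_map (nth x0 s)).
have un : uniq (map (nth x0 s) t).
  rewrite map_inj_in_uniq // => i j /tP[si _] /tP[sj _] /eqP.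
  by rewrite nth_uniq // => /eqP.
rewrite -(card_uniqP un).
apply: (leq_trans _ (leq_bigmax v)); apply: subset_leq_card.
by apply/subsetP => x /mapP[i /tP[_ vi] ->]; rewrite inE.
Qed.

Definition umbrella_free (G : sgraph) (x0 : G) (s : seq G) : Prop :=
  forall a i b, a < i -> i < b -> b < size s ->
    adj (nth x0 s a) (nth x0 s b) -> adj (nth x0 s a) (nth x0 s i).

Definition simplicial (G : sgraph) (v : G) : Prop :=
  forall x y, adj v x -> adj v y -> x != y -> adj x y.

(** A long edge forces a vertex of degree larger than the maximum: its left end
    if some vertex precedes it, and otherwise the end of an edge that leaves the
    clique formed by the first vertices. *)
Lemma no_long_edge (G : sgraph) (x0 : G) (s : seq G) :
  connected_graph G -> ~ complete_graph G ->
  uniq s -> (forall v, v \in s) ->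
  umbrella_free x0 s -> simplicial (nth x0 s 0) ->
  forall i j, i + max_degree G <= j -> j < size s ->
    ~~ adj (nth x0 s i) (nth x0 s j).
Proof.
move=> conn ncomp us alls umb simp i j ij js; apply/negP => uij.
have ltij : i < j.
  rewrite ltn_neqAle (leq_trans (leq_addr _ _) ij) andbT.
  by apply: contraTneq uij => ->; rewrite adj_irrefl.
have right m : i < m -> m <= j -> adj (nth x0 s i) (nth x0 s m).
  move=> im; rewrite leq_eqVlt => /orP[/eqP-> //|mj]; exact: umb uij.
have [i0|i0] := posnP i; last first.
  have [|a [b [ai ib bs uab]]] := connected_crossing_edge x0 (m := i) conn us alls.
    by rewrite i0 (ltn_trans ltij).
  have uia : adj (nth x0 s i) (nth x0 s a).
    rewrite adj_sym; move: ib; rewrite leq_eqVlt => /orP[/eqP-> //|ib].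
    exact: umb uab.
  have : size (a :: iota i.+1 (j - i)) <= max_degree G.
    apply: (@leq_max_degree _ x0 (nth x0 s i) s) => //.
      by rewrite /= iota_uniq mem_iota andbT; lia.
    move=> m; rewrite inE => /orP[/eqP->|].
      by split=> //; lia.
    rewrite mem_iota => /andP[im mj]; split; first by lia.
    by apply: right; lia.
  by rewrite /= size_iota; lia.
rewrite {i}i0 in ij uij ltij right.
have clique c d : c <= j -> d <= j -> c != d -> adj (nth x0 s c) (nth x0 s d).
  case: c d => [|c] [|d] // cj dj cd; [exact: right| |].
    by rewrite adj_sym; apply: right.
  by apply: simp; [exact: right | exact: right |];
    rewrite nth_uniq //; apply: leq_ltn_trans js.
have [sj|sj] := leqP (size s) j.+1.
  apply: ncomp => u v; rewrite -(nth_index x0 (alls u)) -(nth_index x0 (alls v)).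
  rewrite nth_uniq ?index_mem // => uv.
  by apply: clique => //; rewrite -ltnS; apply: leq_trans sj; rewrite index_mem.
have [|a [b [aj jb bs uab]]] := connected_crossing_edge x0 (m := j.+1) conn us alls.
  by rewrite sj.
have : size (b :: rem a (iota 0 j.+1)) <= max_degree G.
  apply: (@leq_max_degree _ x0 (nth x0 s a) s) => //.
    rewrite cons_uniq rem_uniq ?iota_uniq // andbT.
    by apply: contraTN jb => /mem_rem; rewrite mem_iota -ltnNge.
  move=> m; rewrite inE => /orP[/eqP-> //|].
  rewrite mem_rem_uniq ?iota_uniq // inE mem_iota add0n => /andP[ma mj].
  split; first by apply: leq_trans mj _; apply: ltnW.
  by apply: clique => //; rewrite eq_sym.
rewrite -[size (b :: _)]/(size (rem a (iota 0 j.+1))).+1.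
by rewrite size_rem ?mem_iota // size_iota; lia.
Qed.

(** * Interval graphs *)

Lemma mem_itv_convex (R : realType) (J : interval R) (x y z : R) :
  x \in J -> z \in J -> (x <= y)%O -> (y <= z)%O -> y \in J.
Proof.
case: J => a b; rewrite !itv_boundlr => /andP[ax _] /andP[_ zb] xy yz.
by rewrite (le_trans ax) ?(le_trans _ zb) // bnd_simp.
Qed.

(** Replaces arbitrary intervals by closed ones.  One witness point is picked in
    the intersection of each adjacent pair, and each interval shrinks to the hull
    of the witnesses that it contains; this keeps every intersection and, by
    convexity, creates no new one. *)
Lemma interval_graph_closed (R : realType) (G : sgraph) :
  interval_graph R G -> (forall v : G, exists u, adj v u) ->
  exists l r : G -> R, (forall v, (l v <= r v)%O) /\
    forall u v, u != v -> adj u v = (l u <= r v)%O && (l v <= r u)%O.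
Proof.
move=> [I IP] nb.
have /fin_all_exists[pt ptP] : forall p : G * G, exists x : R,
    adj p.1 p.2 -> x \in I p.1 /\ x \in I p.2.
  move=> [u v] /=; case: (boolP (adj u v)) => [uv|_]; last by exists 0%R.
  by have [x xI] := (IP u v (adj_neq uv)).1 uv; exists x.
have /fin_all_exists[lp lpP] : forall v, exists p, pt p \in I v /\
    forall q, pt q \in I v -> (pt p <= pt q)%O.
  move=> v; have [u vu] := nb v; have [p0 _] := ptP (v, u) vu.
  by case: (@arg_minP _ _ _ (v, u) (fun p => pt p \in I v) pt p0) => p; exists p.
have /fin_all_exists[rp rpP] : forall v, exists p, pt p \in I v /\
    forall q, pt q \in I v -> (pt q <= pt p)%O.
  move=> v; have [u vu] := nb v; have [p0 _] := ptP (v, u) vu.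
  by case: (@arg_maxP _ _ _ (v, u) (fun p => pt p \in I v) pt p0) => p; exists p.
exists (pt \o lp), (pt \o rp) => /=.
have lr v : (pt (lp v) <= pt (rp v))%O by apply: (lpP v).2; exact: (rpP v).1.
split=> // u v uv; apply/idP/idP => [auv|/andP[luv lvu]].
  have [pu pv] := ptP (u, v) auv.
  by rewrite (le_trans ((lpP u).2 _ pu) ((rpP v).2 _ pv))
             (le_trans ((lpP v).2 _ pv) ((rpP u).2 _ pu)).
(* The larger of the two left endpoints lies in both intervals. *)
apply/(IP u v uv); case: (leP (pt (lp u)) (pt (lp v))) => [le|/ltW le].
  exists (pt (lp v)); split; last exact: (lpP v).1.
  exact: mem_itv_convex (lpP u).1 (rpP u).1 le lvu.
exists (pt (lp u)); split; first exact: (lpP u).1.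
exact: mem_itv_convex (lpP v).1 (rpP v).1 le luv.
Qed.

(** Sorting by left endpoint alone is umbrella-free; moving the interval that
    ends first to the front preserves this and makes the first vertex
    simplicial. *)
Lemma simplicial_umbrella_enumeration (R : realType) (G : sgraph) (x0 : G)
    (l r : G -> R) :
  (forall v, (l v <= r v)%O) ->
  (forall u v, u != v -> adj u v = (l u <= r v)%O && (l v <= r u)%O) ->
  exists s : seq G, [/\ uniq s, forall v, v \in s,
    umbrella_free x0 s & simplicial (nth x0 s 0)].
Proof.
move=> lr adjE.
have adjlr u v : adj u v -> (l u <= r v)%O /\ (l v <= r u)%O.
  by move=> uv; have := uv; rewrite adjE ?adj_neq // => /andP.
have [w rw] : exists w, forall v, (r w <= r v)%O.
  by case: (@arg_minP _ _ _ x0 predT r isT) => w _ wP; exists w => v; apply: wP.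
pose leL := relpre l <=%O.
pose t := sort leL (rem w (enum G)).
have ut : uniq (w :: t).
  by rewrite /= mem_sort sort_uniq mem_rem_uniq ?enum_uniq // inE eqxx
             rem_uniq ?enum_uniq.
have allt v : v \in w :: t.
  rewrite inE mem_sort mem_rem_uniq ?enum_uniq // !inE mem_enum inE andbT.
  exact: orbN.
have leLt i j : i <= j -> j < size t -> (l (nth x0 t i) <= l (nth x0 t j))%O.
  move=> ij jt; have srt : sorted leL t.
    by apply: sort_sorted => x y; exact: le_total.
  apply: (@sorted_leq_nth _ leL _ _ x0 t srt) => //; rewrite ?inE //.
  - by move=> y x z; exact: le_trans.
  - by move=> x; exact: lexx.
  - exact: leq_ltn_trans jt.
exists (w :: t); split=> //.
  move=> a i b ai ib bs ab; have ait := ltn_trans ib bs.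
  have neq : nth x0 (w :: t) a != nth x0 (w :: t) i.
    by rewrite nth_uniq ?(ltn_trans ai) // neq_ltn ai.
  rewrite adjE //; have [lar lbr] := adjlr _ _ ab.
  case: i b ai ib bs {ait neq} ab lar lbr => [//|i] [//|b] ai ib bs ab lar lbr.
  have lib : (l (nth x0 t i) <= l (nth x0 t b))%O by apply: leLt => //; exact: ltnW.
  have -> : (l (nth x0 (w :: t) i.+1) <= r (nth x0 (w :: t) a))%O.
    exact: le_trans lib lbr.
  rewrite andbT; case: a ai {ab lar lbr} => [_|a ai] /=.
    exact: le_trans (lr w) (rw _).
  apply: le_trans (lr _); apply: leLt => //; first exact: ltnW.
  exact: ltn_trans ib bs.
move=> x y /= /adjlr[_ lx] /adjlr[_ ly] xy.
by rewrite adjE // (le_trans lx (rw _)) (le_trans ly (rw _)).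
Qed.

Theorem theorem1 (R : realType) (n : nat) (G : sgraph) :
  #|G| = n ->
  connected_graph G ->
  interval_graph R G ->
  ~ complete_graph G ->
  equitably_colorable G (max_degree G).
Proof.
move=> _ conn intG ncomp.
have [x0 _|none] := pickP (@predT G); last first.
  by case: ncomp => u; have := none u.
have nb v := connected_has_neighbor v conn ncomp.
have [l [r [lr adjE]]] := interval_graph_closed intG nb.
have [s [us alls umb simp]] := simplicial_umbrella_enumeration x0 lr adjE.
apply: (equitable_of_enumeration _ us alls);
  last exact: no_long_edge us alls umb simp.
have [u x0u] := nb x0.
apply: (leq_trans _ (leq_bigmax x0)).
by apply/card_gt0P; exists u; rewrite inE.
Qed.
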